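(* Let $\theta^0,\theta^1,\theta^\infty_1,\theta^\infty_2\in\mathbb{C}$ with $\theta^0+\theta^1+\theta^\infty_1+\theta^\infty_2=0$, $\theta^0\neq0$, $\theta^1\ne0$. Let $q_1,p_1,q_2,p_2,u$ be holomorphic functions of $(t_1,t_2)$ on a domain of $\{t_1\neq t_2\}\subset\mathbb{C}^2$, with $u\neq0$. Put $G=\mathrm{diag}(1,u)$, $E_2=\mathrm{diag}(0,1)$ and $$\hat A_0=\begin{pmatrix}q_2\\1\end{pmatrix}(p_2,\,-p_2q_2+\theta^0),\quad \hat A_1=\begin{pmatrix}q_1\\1\end{pmatrix}(p_1,\,-p_1q_1+\theta^1),\quad \hat A_\infty=-\begin{pmatrix}0&p_1q_1+p_2q_2+\theta^\infty_1\\1&t_2\end{pmatrix},$$ $$\hat B=\begin{pmatrix}0&p_1q_1+p_2q_2+\theta^\infty_1\\1&0\end{pmatrix}.$$ Consider the linear systems $\frac{\partial Y}{\partial x}=AY$, $\frac{\partial Y}{\partial t_1}=B^{(1)}Y$, $\frac{\partial Y}{\partial t_2}=B^{(2)}Y$ with $$A=G^{-1}\left(\frac{\hat A_0}{x}+\frac{\hat A_1}{x-(t_2-t_1)}+\hat A_\infty+E_2x\right)G,\quad B^{(1)}=G^{-1}\frac{\hat A_1}{x-(t_2-t_1)}G,\quad B^{(2)}=G^{-1}\left(-\frac{\hat A_1}{x-(t_2-t_1)}-E_2x+\hat B\right)G.$$ Then the compatibility conditions $\partial_{t_i}A-\partial_xB^{(i)}+[A,B^{(i)}]=O$ for $i=1,2$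 (for all $x$) are equivalent to the Hamiltonian system $$\frac{\partial q_j}{\partial t_i}=\frac{\partial H_{t_i}}{\partial p_j},\qquad \frac{\partial p_j}{\partial t_i}=-\frac{\partial H_{t_i}}{\partial q_j}\qquad(i,j=1,2),$$ $$H_{t_1}=H_{\mathrm{IV}}(\theta^1,\theta^\infty_1;t_1;q_1,p_1)+p_2q_2p_1+\frac1{t_1-t_2}\{p_1(q_1-q_2)-\theta^1\}\{p_2(q_2-q_1)-\theta^0\},$$ $$H_{t_2}=H_{\mathrm{IV}}(\theta^0,\theta^\infty_1;t_2;q_2,p_2)+p_1q_1p_2+\frac1{t_2-t_1}\{p_1(q_1-q_2)-\theta^1\}\{p_2(q_2-q_1)-\theta^0\},$$ together with $$\frac1u\frac{\partial u}{\partial t_1}=-p_1,\qquad \frac1u\frac{\partial u}{\partial t_2}=t_2-p_2 .$$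
   Context: $H_{\mathrm{IV}}(\alpha,\beta;t;q,p)=pq(p-q-t)+\beta p+\alpha q$ is the Hamiltonian of the fourth Painlevé equation. The Hamiltonians $H_{t_1},H_{t_2}$ are those of the degenerate Garnier system $H_{\mathrm{Gar}}^{3+1+1}$; the linear system has spectral type $((1))((1)),11,11$. *)

(* Defs.v *)
From HB Require Import structures.
From mathcomp Require Import all_boot all_order all_algebra.
From mathcomp Require Import all_classical all_reals all_analysis.
From mathcomp Require Import complex.
Set Implicit Arguments.
Unset Strict Implicit.
Unset Printing Implicit Defensive.
Import Order.TTheory GRing.Theory Num.Theory numFieldNormedType.Exports.
Local Open Scope classical_set_scope.
Local Open Scope ring_scope.

(* The complex numbers, packaged as a numFieldType so that they carry the
   normed topology (and the complex derivative) that every numFieldType has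
   over itself; [R[i]] as a bare type does not have these instances. *)
Definition Cplx (R : realType) : numFieldType := R[i].

Section Setting.
Variable K : numFieldType.
Implicit Types (U : set (K * K)) (f : K * K -> K) (t : K * K).

Definition domain U := [/\ open U, connected U & U !=set0].

(* [differentiable] is Frechet differentiability over K, hence complex
   differentiability for K = Cplx R. *)
Definition holomorphic_on U f := forall t, U t -> differentiable f t.

(* Directions of the partial derivatives with respect to t_1 and t_2. *)
Definition e1 : K * K := (1, 0).
Definition e2 : K * K := (0, 1).

Definition mx_of m n (s : seq (seq K)) : 'M[K]_(m, n) :=
  \matrix_(i < m, j < n) nth 0 (nth [::] s i) j.

(* Entrywise directional derivative. *)
Definition mx_derive m n (V : normedModType K) (v : V) (M : V -> 'M[K]_(m, n))
    (a : V) : 'M[K]_(m, n) :=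
  \matrix_(i < m, j < n) 'D_v (fun s => M s i j) a.

Definition commutator n (M N : 'M[K]_n) : 'M[K]_n := M *m N - N *m M.

(* d_t A - d_x B + [A, B] = O at the point (x, t), where d_t is the
   derivative in the direction v. *)
Definition compatible n (v : K * K) (A B : K -> K * K -> 'M[K]_n)
    (x : K) (t : K * K) : Prop :=
  mx_derive v (A x) t - mx_derive (1 : K) (B^~ t) x
    + commutator (A x t) (B x t) = 0.

Section LinearSystem.
Variables (th0 th1 thi1 : K) (q1 p1 q2 p2 u : K * K -> K).

Definition gauge t : 'M[K]_2 := mx_of 2 2 [:: [:: 1; 0]; [:: 0; u t]].

Definition E2 : 'M[K]_2 := mx_of 2 2 [:: [:: 0; 0]; [:: 0; 1]].

Definition hatA0 t : 'M[K]_2 :=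
  mx_of 2 1 [:: [:: q2 t]; [:: 1]]
  *m mx_of 1 2 [:: [:: p2 t; - (p2 t * q2 t) + th0]].

Definition hatA1 t : 'M[K]_2 :=
  mx_of 2 1 [:: [:: q1 t]; [:: 1]]
  *m mx_of 1 2 [:: [:: p1 t; - (p1 t * q1 t) + th1]].

Definition hatAoo t : 'M[K]_2 :=
  - mx_of 2 2 [:: [:: 0; p1 t * q1 t + p2 t * q2 t + thi1]; [:: 1; t.2]].

Definition hatB t : 'M[K]_2 :=
  mx_of 2 2 [:: [:: 0; p1 t * q1 t + p2 t * q2 t + thi1]; [:: 1; 0]].

Definition matA (x : K) t : 'M[K]_2 :=
  invmx (gauge t)
  *m (x^-1 *: hatA0 t + (x - (t.2 - t.1))^-1 *: hatA1 t + hatAoo t + x *: E2)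
  *m gauge t.

Definition matB1 (x : K) t : 'M[K]_2 :=
  invmx (gauge t) *m ((x - (t.2 - t.1))^-1 *: hatA1 t) *m gauge t.

Definition matB2 (x : K) t : 'M[K]_2 :=
  invmx (gauge t)
  *m (- ((x - (t.2 - t.1))^-1 *: hatA1 t) - x *: E2 + hatB t)
  *m gauge t.

End LinearSystem.

Definition H_IV (alpha beta t q p : K) : K :=
  p * q * (p - q - t) + beta * p + alpha * q.

Section Hamiltonians.
Variables (th0 th1 thi1 : K).

Definition H_t1 (t1 t2 q1 p1 q2 p2 : K) : K :=
  H_IV th1 thi1 t1 q1 p1 + p2 * q2 * p1
  + (t1 - t2)^-1 * ((p1 * (q1 - q2) - th1) * (p2 * (q2 - q1) - th0)).

Definition H_t2 (t1 t2 q1 p1 q2 p2 : K) : K :=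
  H_IV th0 thi1 t2 q2 p2 + p1 * q1 * p2
  + (t2 - t1)^-1 * ((p1 * (q1 - q2) - th1) * (p2 * (q2 - q1) - th0)).

End Hamiltonians.

(* Hamilton's equations, for the time derivative in the direction v, of the
   Hamiltonian H = H(t1, t2, q1, p1, q2, p2), at the point t. *)
Definition hamilton_eqs (v : K * K) (H : K -> K -> K -> K -> K -> K -> K)
    (q1 p1 q2 p2 : K * K -> K) (t : K * K) : Prop :=
  [/\ 'D_v q1 t = derive1 (fun y => H t.1 t.2 (q1 t) y (q2 t) (p2 t)) (p1 t),
      'D_v p1 t = - derive1 (fun y => H t.1 t.2 y (p1 t) (q2 t) (p2 t)) (q1 t),
      'D_v q2 t = derive1 (fun y => H t.1 t.2 (q1 t) (p1 t) (q2 t) y) (p2 t) &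
      'D_v p2 t = - derive1 (fun y => H t.1 t.2 (q1 t) (p1 t) y (p2 t)) (q2 t)].

End Setting.

Arguments e1 {K}.
Arguments e2 {K}.

(* Main.v *)
Require Import Defs.
From HB Require Import structures.
From mathcomp Require Import all_boot all_order all_algebra.
From mathcomp Require Import all_classical all_reals all_analysis.
From mathcomp Require Import complex ring.
Set Implicit Arguments.
Unset Strict Implicit.
Unset Printing Implicit Defensive.
Import Order.TTheory GRing.Theory Num.Theory numFieldNormedType.Exports.
Local Open Scope classical_set_scope.
Local Open Scope ring_scope.

(** Everything happens at a fixed point [t] and in a fixed time direction [v];
    write [s = t_2 - t_1].

    Conjugation by the gauge [G = diag(1, u)] only adds [w E_2], with
    [w = u^-1 'D_v u], to the second matrix of the pair: the zero-curvature
    expression of the conjugated pair is conjugate to the one of the pair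
    [(A, B + w E_2)] before conjugation ([compatible_gauge]).

    In that expression the double poles at [x = s] and the terms linear in [x]
    cancel, so that it has the form [x^-1 R_0 + (x - s)^-1 R_1 + R_oo]
    ([pole_decomposition]); hence it vanishes for all [x] if and only if
    [R_0 = R_1 = R_oo = 0] ([compatible_poles]). The equations [R_0 = 0] and
    [R_1 = 0] are Lax equations [dA_i + [A_i, M_i] = 0] for the residues.

    Each residue is a rank-one matrix [(q, 1)^T (p, th - p q)] of trace [th].
    When [th] is nonzero, its Lax equation is equivalent to a pair of formulas
    for the derivatives of [q] and [p] ([rank_one_isospectral]). The lower left
    entry of [R_oo = 0] gives [w], that is, the equation for [u]; inserting this
    value in the four formulas yields Hamilton's equations. Conversely,
    Hamilton's equations together with the value of [w] imply [R_0 = R_1 = 0],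
    and the remaining entries of [R_oo] then vanish by substitution. *)

(** * Derivatives of matrix-valued functions *)

Section MatrixDerivative.
Variables (K : numFieldType) (V : normedModType K).
Implicit Types (a v : V).

Definition mx_is_derive m n a v (M : V -> 'M[K]_(m, n)) (dM : 'M[K]_(m, n)) :=
  forall i j, is_derive a v (fun s => M s i j) (dM i j).

Lemma mx_derive_val m n a v (M : V -> 'M[K]_(m, n)) dM :
  mx_is_derive a v M dM -> mx_derive v M a = dM.
Proof.
move=> dMP; apply/matrixP => i j.
by rewrite mxE (@derive_val _ _ _ _ _ _ _ (dMP i j)).
Qed.

Lemma mx_is_derive_cst m n a v (C : 'M[K]_(m, n)) :
  mx_is_derive a v (fun=> C) 0.
Proof. by move=> i j; rewrite mxE; exact: is_derive_cst. Qed.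

Lemma mx_is_deriveD m n a v (M N : V -> 'M[K]_(m, n)) dM dN :
  mx_is_derive a v M dM -> mx_is_derive a v N dN ->
  mx_is_derive a v (fun s => M s + N s) (dM + dN).
Proof.
move=> dMP dNP i j; rewrite mxE; under eq_fun do rewrite mxE.
exact: is_deriveD.
Qed.

Lemma mx_is_deriveN m n a v (M : V -> 'M[K]_(m, n)) dM :
  mx_is_derive a v M dM -> mx_is_derive a v (fun s => - M s) (- dM).
Proof.
move=> dMP i j; rewrite mxE; under eq_fun do rewrite mxE.
exact: is_deriveN.
Qed.

Lemma mx_is_deriveZ m n a v (c : V -> K) (M : V -> 'M[K]_(m, n)) dc dM :
  is_derive a v c dc -> mx_is_derive a v M dM ->
  mx_is_derive a v (fun s => c s *: M s) (dc *: M a + c a *: dM).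
Proof.
move=> dcP dMP i j; rewrite !mxE; under eq_fun do rewrite mxE.
apply: is_derive_eq (is_deriveM dcP (dMP i j)) _.
by rewrite addrC; congr (_ + _); exact: mulrC.
Qed.

Lemma mx_is_deriveM m n p a v (M : V -> 'M[K]_(m, n)) (N : V -> 'M[K]_(n, p))
    dM dN :
  mx_is_derive a v M dM -> mx_is_derive a v N dN ->
  mx_is_derive a v (fun s => M s *m N s) (dM *m N a + M a *m dN).
Proof.
move=> dMP dNP i j; rewrite !mxE -big_split /=; under eq_fun do rewrite mxE.
have -> : (fun s => \sum_k M s i k * N s k j) =
  \sum_k (fun s => M s i k * N s k j) by apply/funext => s; rewrite fct_sumE.
apply: is_derive_sum => k.
apply: is_derive_eq (is_deriveM (dMP i k) (dNP k j)) _.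
by rewrite addrC; congr (_ + _); exact: mulrC.
Qed.

Lemma is_derive_affine (f : V -> K) a v (c : K) :
  (forall h : K, f (h *: v + a) = f a + h * c) -> is_derive a v f c.
Proof.
move=> fE.
have H : (fun h : K => h^-1 *: ((f \o shift a) (h *: v) - f a)) @ 0^' --> c.
  apply: cvg_near_cst; near=> h.
  rewrite /= fE addrC addKr [_ *: _]mulKf //.
  by near: h; exact: nbhs_dnbhs_neq.
apply: DeriveDef; first by apply/cvg_ex; exists c.
exact: cvg_lim H.
Unshelve. all: end_near. Qed.

Lemma is_deriveV_fun a v (c : V -> K) dc : c a != 0 -> is_derive a v c dc ->
  is_derive a v (fun s => (c s)^-1) (- (c a) ^- 2 * dc).
Proof.
move=> ca0 dcP; apply: DeriveDef; first exact: derivableV.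
by rewrite deriveV// derive_val.
Qed.

End MatrixDerivative.

(** * Algebra of two by two matrices *)

Section Algebra.
Variable K : numFieldType.
Implicit Types (M N : 'M[K]_2).

Lemma mx2_eq M N :
  M 0 0 = N 0 0 -> M 0 1 = N 0 1 -> M 1 0 = N 1 0 -> M 1 1 = N 1 1 -> M = N.
Proof.
move=> h00 h01 h10 h11; apply/matrixP => i j.
have ord2 (k : 'I_2) : k = 0 \/ k = 1.
  by case: k => [[|[|//]] ?]; [left|right]; apply/val_inj.
by case: (ord2 i) (ord2 j) => -> [] ->.
Qed.

Lemma mx2_eq0 M :
  M = 0 <-> [/\ M 0 0 = 0, M 0 1 = 0, M 1 0 = 0 & M 1 1 = 0].
Proof.
by split=> [->|[? ? ? ?]]; [rewrite !mxE|apply: mx2_eq; rewrite mxE].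
Qed.

Lemma mulmx2E M N i j : (M *m N) i j = M i 0 * N 0 j + M i 1 * N 1 j.
Proof.
rewrite !mxE big_ord_recl big_ord1.
by congr (_ + M i _ * N _ j); apply/val_inj.
Qed.

Lemma commutator2E M N i j : commutator M N i j =
  M i 0 * N 0 j + M i 1 * N 1 j - (N i 0 * M 0 j + N i 1 * M 1 j).
Proof. by rewrite !mxE -!mulmx2E !mxE. Qed.

(** Three values of [x] determine the three coefficients; [-s], [2 s] and [3 s]
    avoid the poles [0] and [s] in characteristic zero. *)
Lemma partial_fractions m n (s : K) (X Y Z : 'M[K]_(m, n)) : s != 0 ->
  (forall x, x != 0 -> x != s -> x^-1 *: X + (x - s)^-1 *: Y + Z = 0) ->
  [/\ X = 0, Y = 0 & Z = 0].
Proof.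
move=> s0 H.
have n2 : 2 != 0 :> K by rewrite pnatr_eq0.
have n3 : 3 != 0 :> K by rewrite pnatr_eq0.
have E i j : [/\ X i j = 0, Y i j = 0 & Z i j = 0].
  have {}H x : x != 0 -> x != s ->
      x^-1 * X i j + (x - s)^-1 * Y i j + Z i j = 0.
    by move=> x0 xs; have /matrixP/(_ i j) := H x x0 xs; rewrite !mxE.
  have h1 : (- s) ^-1 * X i j + (- s - s)^-1 * Y i j + Z i j = 0.
    apply: H; rewrite ?oppr_eq0//.
    by rewrite -subr_eq0 -opprD oppr_eq0 -mulr2n mulrn_eq0.
  have h2 : (2 * s) ^-1 * X i j + (2 * s - s)^-1 * Y i j + Z i j = 0.
    apply: H; first by rewrite mulf_neq0.
    by rewrite -subr_eq0 (_ : _ - s = s) //; ring.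
  have h3 : (3 * s) ^-1 * X i j + (3 * s - s)^-1 * Y i j + Z i j = 0.
    apply: H; first by rewrite mulf_neq0.
    by rewrite -subr_eq0 (_ : _ - s = 2 * s) ?mulf_neq0 //; ring.
  move: h1 h2 h3.
  rewrite (_ : - s - s = - (2 * s)); last by ring.
  rewrite (_ : 2 * s - s = s); last by ring.
  rewrite (_ : 3 * s - s = 2 * s); last by ring.
  set h1 := (X in X = 0 -> _); set h2 := (X in _ -> X = 0 -> _).
  set h3 := (X in _ -> _ -> X = 0 -> _) => h10 h20 h30.
  (* the inverse of the linear system formed by h1, h2 and h3 *)
  have -> : X i j = s * (- h1 - 2 * h2 + 3 * h3).
    by rewrite /h1 /h2 /h3; field.
  have -> : Y i j = s * (h1 / 3 + 8 / 3 * h2 - 3 * h3).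
    by rewrite /h1 /h2 /h3; field.
  have -> : Z i j = h1 / 6 - 2 / 3 * h2 + 3 / 2 * h3.
    by rewrite /h1 /h2 /h3; field.
  by rewrite h10 h20 h30; split; ring.
by split; apply/matrixP => i j; rewrite mxE; case: (E i j).
Qed.

Lemma E2E : [/\ E2 K 0 0 = 0, E2 K 0 1 = 0, E2 K 1 0 = 0 & E2 K 1 1 = 1].
Proof. by rewrite !mxE. Qed.

(** The second matrix has residue [- sg A_1] at [s] and grows like [- c E_2 x] at
    infinity. Both time directions are instances: [sg = -1],
    [c = 0] for [t_1], and [sg = c = 1] for [t_2]; [sg] is the velocity of the
    pole [s]. The identity is bilinear algebra based on
    [1/(x (x - s)) = (1/(x - s) - 1/x)/s] and [x/(x - s) = 1 + s/(x - s)]: the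
    double pole created by moving [s] is cancelled by the one in the
    [x]-derivative of the second matrix, and the coefficient of [x] is
    [c [E_2, Aoo + Bh]], which is zero when [Aoo + Bh] is diagonal. *)
Lemma pole_decomposition (sg c w x s : K)
    (A0 A1 Aoo Bh dA0 dA1 dAoo : 'M[K]_2) :
  x != 0 -> x - s != 0 -> s != 0 -> commutator (E2 K) (Aoo + Bh) = 0 ->
  x^-1 *: dA0 + (x - s)^-1 *: dA1 + (sg * (x - s)^-2) *: A1 + dAoo
  - ((sg * (x - s)^-2) *: A1 - c *: E2 K)
  + commutator (x^-1 *: A0 + (x - s)^-1 *: A1 + Aoo + x *: E2 K)
      (- sg *: ((x - s)^-1 *: A1) + c *: (Bh - x *: E2 K) + w *: E2 K)
  = x^-1 *: (dA0 + commutator A0 ((sg / s) *: A1 + c *: Bh + w *: E2 K))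
    + (x - s)^-1 *: (dA1 + commutator A1
        (sg *: (s^-1 *: A0 + Aoo + s *: E2 K) + c *: (Bh - s *: E2 K)
         + w *: E2 K))
    + (dAoo + c *: E2 K + (sg - c) *: commutator A1 (E2 K)
       - c *: commutator A0 (E2 K) + commutator Aoo (c *: Bh + w *: E2 K)).
Proof.
move=> x0 xs s0.
case: E2E => e00 e01 e10 e11.
move=> /mx2_eq0[]; rewrite !commutator2E ![(Aoo + Bh) _ _]mxE e00 e01 e10 e11.
move=> _ h01 h10 _.
have {}h01 : Bh 0 1 = - Aoo 0 1.
  by apply/eqP; rewrite -subr_eq0 -oppr_eq0 -h01; apply/eqP; ring.
have {}h10 : Bh 1 0 = - Aoo 1 0.
  by apply/eqP; rewrite -subr_eq0 -h10; apply/eqP; ring.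
have ZE a (M : 'M[K]_2) i j : (a *: M) i j = a * M i j by rewrite mxE.
have DE (M N : 'M[K]_2) i j : (M + N) i j = M i j + N i j by rewrite mxE.
have NE (M : 'M[K]_2) i j : (- M) i j = - M i j by rewrite mxE.
apply: mx2_eq; rewrite ?(commutator2E, DE, NE, ZE).
  all: rewrite ?(e00, e01, e10, e11, h01, h10).
  all: field; do ?(apply/andP; split).
  all: done.
Qed.

(** Write [A = f g] with [f = (q, 1)^T] and [g = (p, th - p q)]. The Lax equation
    reads [(f' - M f) g + f (g' + g M) = 0]; as [g f = th] is nonzero, it forces
    [f' - M f] to be a multiple of [f], and [g' + g M] the opposite multiple of
    [g]. The second entry of [f] is constant, which fixes the multiple. *)
Lemma rank_one_isospectral (q p th dq dp : K) M : th != 0 ->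
  let A := mx_of 2 1 [:: [:: q]; [:: 1]]
    *m mx_of 1 2 [:: [:: p; - (p * q) + th]] in
  let dA := mx_of 2 1 [:: [:: dq]; [:: 0]]
      *m mx_of 1 2 [:: [:: p; - (p * q) + th]]
    + mx_of 2 1 [:: [:: q]; [:: 1]]
      *m mx_of 1 2 [:: [:: dp; - (dp * q + p * dq)]] in
  dA + commutator A M = 0 <->
  dq = M 0 0 * q + M 0 1 - q * (M 1 0 * q + M 1 1) /\
  dp = p * (M 1 0 * q + M 1 1) - (p * M 0 0 + (th - p * q) * M 1 0).
Proof.
move=> th0 A dA.
rewrite mx2_eq0 ![(_ + commutator _ _) _ _]mxE !commutator2E.
rewrite /dA /A !mxE !big_ord1 !mxE /=.
split=> [[h00 h01 h10 h11]|[-> ->]].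
  have -> : dp = p * (M 1 0 * q + M 1 1) - (p * M 0 0 + (th - p * q) * M 1 0).
    by apply/eqP; rewrite -subr_eq0 -h10; apply/eqP; ring.
  split=> //; apply: (mulfI th0).
  (* contract the Lax equation with f on the right, where g f = th, and take
     the component of the column transverse to f *)
  apply/eqP; rewrite -subr_eq0; apply/eqP; move: h00 h01 h10 h11.
  set a := (X in X = 0 -> _); set b := (X in _ -> X = 0 -> _).
  set c := (X in _ -> _ -> X = 0 -> _).
  set d := (X in _ -> _ -> _ -> X = 0 -> _) => a0 b0 c0 d0.
  transitivity (q * (a - q * c) + (b - q * d)).
    by rewrite /a /b /c /d; ring.
  by rewrite a0 b0 c0 d0; ring.
by split; ring.
Qed.

End Algebra.

(** * Gauge transformation and separation of the poles *)

Section Gauge.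
Variable K : numFieldType.
Implicit Types (t v : K * K) (u q p : K * K -> K).

Lemma is_derive_time_gap t v :
  is_derive t v (fun s : K * K => s.2 - s.1) (v.2 - v.1).
Proof.
apply: is_derive_affine => h; case: t v => [t1 t2] [v1 v2].
rewrite -[LHS]/(h * v2 + t2 - (h * v1 + t1)) /=; ring.
Qed.

Lemma gauge_unit u t : u t != 0 -> gauge u t \in unitmx.
Proof.
move=> ut0.
apply: proj1 (mulmx1_unit (B := mx_of 2 2 [:: [:: 1; 0]; [:: 0; (u t)^-1]]) _).
by apply: mx2_eq; rewrite mulmx2E !mxE /=; field.
Qed.

Lemma invmx_gauge u t : u t != 0 ->
  invmx (gauge u t) = mx_of 2 2 [:: [:: 1; 0]; [:: 0; (u t)^-1]].
Proof.
move=> ut0; rewrite -[RHS](mulKmx (gauge_unit ut0)) -[LHS]mulmx1.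
congr (_ *m _); apply/esym.
by apply: mx2_eq; rewrite mulmx2E !mxE /=; field.
Qed.

Lemma mx_is_derive_gauge u t v : derivable u t v ->
  mx_is_derive t v (gauge u) ('D_v u t *: E2 K).
Proof.
move=> /derivableP du [[|[|//]] ?] [[|[|//]] ?]; rewrite !mxE /=;
  under eq_fun do rewrite mxE /=; rewrite ?mulr0 ?mulr1 //; exact: is_derive_cst.
Qed.

Lemma mx_is_derive_invmx_gauge u t v :
  (\forall s \near t, u s != 0) -> derivable u t v ->
  mx_is_derive t v (fun s => invmx (gauge u s))
    (- (u t) ^- 2 * 'D_v u t *: E2 K).
Proof.
move=> u0 du i j; apply: near_eq_is_derive.
  near=> s; rewrite invmx_gauge; first reflexivity.
  by near: s.
have ut0 : u t != 0 by exact: nbhs_singleton u0.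
have /derivableP/(is_deriveV_fun ut0) du' := du.
case: i j => [[|[|//]] ?] [[|[|//]] ?]; rewrite !mxE /=;
  under eq_fun do rewrite mxE /=; rewrite ?mulr0 ?mulr1 //; exact: is_derive_cst.
Unshelve. all: end_near. Qed.

(** By the product rule, conjugation by the gauge turns [dA] into the conjugate
    of [dA + [A, dG G^-1]], where [dG G^-1 = (u^-1 'D_v u) E_2]; the other terms
    are merely conjugated. *)
Lemma compatible_gauge u v (A B : K -> K * K -> 'M[K]_2) dtA dxB x t :
  (\forall s \near t, u s != 0) -> derivable u t v ->
  mx_is_derive t v (A x) dtA -> mx_is_derive x 1 (B^~ t) dxB ->
  compatible v (fun x s => invmx (gauge u s) *m A x s *m gauge u s)
    (fun x s => invmx (gauge u s) *m B x s *m gauge u s) x t <->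
  dtA - dxB + commutator (A x t) (B x t + ((u t)^-1 * 'D_v u t) *: E2 K) = 0.
Proof.
move=> u0 du dA dB.
have ut0 : u t != 0 by exact: nbhs_singleton u0.
have gu := gauge_unit ut0.
have dG := mx_is_derive_gauge du.
have dGV := mx_is_derive_invmx_gauge u0 du.
rewrite /compatible (mx_derive_val (mx_is_deriveM (mx_is_deriveM dGV dA) dG)).
rewrite (mx_derive_val (mx_is_deriveM (mx_is_deriveM (mx_is_derive_cst _ _ _) dB)
  (mx_is_derive_cst _ _ _))).
set C := dtA - dxB + _.
rewrite (_ : _ + commutator _ _ = invmx (gauge u t) *m C *m gauge u t); last first.
  rewrite /C invmx_gauge //; apply: mx2_eq;
    by rewrite !(commutator2E, mulmx2E, mxE) /=; field.
split=> [H|->]; last by rewrite mulmx0 mul0mx.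
have -> : C = gauge u t *m (invmx (gauge u t) *m C *m gauge u t)
    *m invmx (gauge u t).
  by rewrite !mulmxA mulmxV // mul1mx mulmxK.
by rewrite H mulmx0 mul0mx.
Qed.

(** The three equations do not involve [x]: two Lax equations for the residues at
    [0] and [s], and the condition at infinity. *)
Lemma compatible_poles u v (A0 A1 Aoo Bh : K * K -> 'M[K]_2) dA0 dA1 dAoo
    (sg c : K) t :
  let s := t.2 - t.1 in
  let w := (u t)^-1 * 'D_v u t in
  s != 0 -> v.2 - v.1 = sg ->
  commutator (E2 K) (Aoo t + Bh t) = 0 ->
  (\forall s \near t, u s != 0) -> derivable u t v ->
  mx_is_derive t v A0 dA0 -> mx_is_derive t v A1 dA1 ->
  mx_is_derive t v Aoo dAoo ->
  (forall x, x != 0 -> x != s ->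
    compatible v
      (fun x t => invmx (gauge u t)
        *m (x^-1 *: A0 t + (x - (t.2 - t.1))^-1 *: A1 t + Aoo t + x *: E2 K)
        *m gauge u t)
      (fun x t => invmx (gauge u t)
        *m (- sg *: ((x - (t.2 - t.1))^-1 *: A1 t) + c *: (Bh t - x *: E2 K))
        *m gauge u t) x t) <->
  [/\ dA0 + commutator (A0 t) ((sg / s) *: A1 t + c *: Bh t + w *: E2 K) = 0,
      dA1 + commutator (A1 t) (sg *: (s^-1 *: A0 t + Aoo t + s *: E2 K)
        + c *: (Bh t - s *: E2 K) + w *: E2 K) = 0 &
      dAoo + c *: E2 K + (sg - c) *: commutator (A1 t) (E2 K)
        - c *: commutator (A0 t) (E2 K)
        + commutator (Aoo t) (c *: Bh t + w *: E2 K) = 0].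
Proof.
move=> s w s0 vsg BhAoo u0 du dA0P dA1P dAooP.
pose A x t := x^-1 *: A0 t + (x - (t.2 - t.1))^-1 *: A1 t + Aoo t + x *: E2 K.
pose B x t := - sg *: ((x - (t.2 - t.1))^-1 *: A1 t) + c *: (Bh t - x *: E2 K).
have E (x : K) : x != 0 -> x != s ->
    compatible v (fun x s => invmx (gauge u s) *m A x s *m gauge u s)
      (fun x s => invmx (gauge u s) *m B x s *m gauge u s) x t <->
    x^-1 *: (dA0 + commutator (A0 t) ((sg / s) *: A1 t + c *: Bh t + w *: E2 K))
    + (x - s)^-1 *: (dA1 + commutator (A1 t)
        (sg *: (s^-1 *: A0 t + Aoo t + s *: E2 K) + c *: (Bh t - s *: E2 K)
          + w *: E2 K))
    + (dAoo + c *: E2 K + (sg - c) *: commutator (A1 t) (E2 K)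
       - c *: commutator (A0 t) (E2 K)
       + commutator (Aoo t) (c *: Bh t + w *: E2 K)) = 0.
  move=> x0 xs; have xs0 : x - s != 0 by rewrite subr_eq0.
  rewrite -pole_decomposition //.
  apply: (@compatible_gauge u v A B) => //.
    have dpole : is_derive t v (fun t => (x - (t.2 - t.1))^-1) (sg * (x - s)^-2).
      apply: is_derive_eq (is_deriveV_fun _ (is_deriveB (is_derive_cst x t v)
        (is_derive_time_gap t v))) _ => //.
      by rewrite vsg sub0r mulrNN mulrC.
    move=> i j.
    apply: is_derive_eq (mx_is_deriveD (mx_is_deriveD (mx_is_deriveD
      (mx_is_deriveZ (is_derive_cst x^-1 t v) dA0P)
      (mx_is_deriveZ dpole dA1P)) dAooP)
      (mx_is_derive_cst _ _ (x *: E2 K)) i j) _.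
    rewrite !mxE /cst /= -/s; ring.
  have dpole : is_derive x 1 (fun y => (y - s)^-1) (- (x - s)^-2).
    apply: is_derive_eq (is_deriveV_fun _ (is_deriveB (is_derive_id x 1)
      (is_derive_cst s x 1))) _ => //.
    by rewrite subr0 mulr1.
  move=> i j.
  apply: is_derive_eq (mx_is_deriveD
    (mx_is_deriveZ (is_derive_cst (- sg) x 1)
      (mx_is_deriveZ dpole (mx_is_derive_cst _ _ (A1 t))))
    (mx_is_deriveZ (is_derive_cst c x 1)
      (mx_is_deriveD (mx_is_derive_cst _ _ (Bh t))
        (mx_is_deriveN (mx_is_deriveZ (is_derive_id _ _)
          (mx_is_derive_cst _ _ (E2 K)))))) i j) _.
  rewrite !mxE /cst /= -/s; ring.
split=> [H|[R0 R1 Roo] x x0 xs].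
  by apply: (partial_fractions s0) => x x0 xs; apply/(E x x0 xs)/H.
by apply/(E x x0 xs); rewrite R0 R1 Roo !scaler0 !addr0.
Qed.
End Gauge.

(** * Gradients of the Hamiltonians *)

Section Hamiltonian.
Variable K : numFieldType.

Lemma derive1_quadratic (f : K -> K) (a b y : K) :
  (forall z, f z = a * z ^+ 2 + b * z + f 0) -> derive1 f y = 2 * a * y + b.
Proof.
move=> fE; rewrite derive1E.
have -> : f = (a \*: (id ^+ 2 : K -> K)) + (b \*: (id : K -> K)) + cst (f 0).
  by apply/funext => z; rewrite fE.
rewrite (@derive_val _ _ _ _ _ _ _ (is_deriveD (is_deriveD
  (is_deriveZ a (is_deriveX 2 (is_derive_id y 1)))
  (is_deriveZ b (is_derive_id y 1)))
  (is_derive_cst (f 0) y 1))) /GRing.scale /=; ring.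
Qed.

Lemma H_t1_gradient (th0 th1 thi1 t1 t2 q1 p1 q2 p2 : K) :
  let H := H_t1 th0 th1 thi1 t1 t2 in
  let r := (t1 - t2)^-1 in
  [/\ derive1 (fun y => H q1 y q2 p2) p1 =
        2 * q1 * p1 - q1 * (q1 + t1) + thi1 + p2 * q2
        + r * (q1 - q2) * (p2 * (q2 - q1) - th0),
      derive1 (fun y => H y p1 q2 p2) q1 =
        - 2 * p1 * q1 + p1 * (p1 - t1) + th1
        + r * (p1 * (p2 * (q2 - q1) - th0) - p2 * (p1 * (q1 - q2) - th1)),
      derive1 (fun y => H q1 p1 q2 y) p2 =
        q2 * p1 + r * (p1 * (q1 - q2) - th1) * (q2 - q1) &
      derive1 (fun y => H q1 p1 y p2) q2 =
        p2 * p1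
        + r * (p2 * (p1 * (q1 - q2) - th1) - p1 * (p2 * (q2 - q1) - th0))].
Proof.
move=> H r; split.
- rewrite (@derive1_quadratic _ q1 (- q1 * (q1 + t1) + thi1 + p2 * q2
    + r * (q1 - q2) * (p2 * (q2 - q1) - th0))); first by ring.
  by move=> z; rewrite /H /H_t1 /H_IV -/r; ring.
- rewrite (@derive1_quadratic _ (- p1 - r * p1 * p2) (p1 * (p1 - t1) + th1
    + r * (p1 * (p2 * q2 - th0) + p2 * (p1 * q2 + th1)))); first by ring.
  by move=> z; rewrite /H /H_t1 /H_IV -/r; ring.
- rewrite (@derive1_quadratic _ 0 (q2 * p1
    + r * (p1 * (q1 - q2) - th1) * (q2 - q1))); first by ring.
  by move=> z; rewrite /H /H_t1 /H_IV -/r; ring.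
- rewrite (@derive1_quadratic _ (- r * p1 * p2) (p2 * p1
    + r * (p1 * (p2 * q1 + th0) + p2 * (p1 * q1 - th1)))); first by ring.
  by move=> z; rewrite /H /H_t1 /H_IV -/r; ring.
Qed.

(** The two Hamiltonians are exchanged by swapping the indices of all data. *)
Lemma H_t2E (th0 th1 thi1 t1 t2 q1 p1 q2 p2 : K) :
  H_t2 th0 th1 thi1 t1 t2 q1 p1 q2 p2 = H_t1 th1 th0 thi1 t2 t1 q2 p2 q1 p1.
Proof. by rewrite /H_t1 /H_t2 [X in _ + _ * X]mulrC. Qed.

End Hamiltonian.

(** * The deformation equations at a point *)

Section Pointwise.
Variable K : numFieldType.
Variables (th0 th1 thi1 : K) (q1 p1 q2 p2 u : K * K -> K) (t v : K * K).
Hypotheses (th0_neq0 : th0 != 0) (th1_neq0 : th1 != 0) (t12 : t.1 != t.2).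
Hypotheses (dq1 : derivable q1 t v) (dp1 : derivable p1 t v).
Hypotheses (dq2 : derivable q2 t v) (dp2 : derivable p2 t v).
Hypotheses (du : derivable u t v) (u0 : \forall s \near t, u s != 0).

Lemma mx_is_derive_hatA0 th (q p : K * K -> K) :
  derivable q t v -> derivable p t v ->
  mx_is_derive t v (hatA0 th q p)
    (mx_of 2 1 [:: [:: 'D_v q t]; [:: 0]]
      *m mx_of 1 2 [:: [:: p t; - (p t * q t) + th]]
     + mx_of 2 1 [:: [:: q t]; [:: 1]]
      *m mx_of 1 2 [:: [:: 'D_v p t; - ('D_v p t * q t + p t * 'D_v q t)]]).
Proof.
move=> /derivableP dq /derivableP dp; apply: mx_is_deriveM => i j.
  case: i j => [[|[|//]] ?] [[|//] ?]; rewrite mxE /=;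
    under eq_fun do rewrite mxE /=; [exact: dq|exact: is_derive_cst].
case: i j => [[|//] ?] [[|[|//]] ?]; rewrite mxE /=;
  under eq_fun do rewrite mxE /=; first exact: dp.
apply: is_derive_eq (is_deriveD (is_deriveN (is_deriveM dp dq))
  (is_derive_cst th t v)) _.
by rewrite addr0 addrC; congr (- (_ + _)); exact: mulrC.
Qed.

Lemma mx_is_derive_hatAoo :
  mx_is_derive t v (hatAoo thi1 q1 p1 q2 p2)
    (- mx_of 2 2 [:: [:: 0; 'D_v p1 t * q1 t + p1 t * 'D_v q1 t
                            + ('D_v p2 t * q2 t + p2 t * 'D_v q2 t)];
                     [:: 0; v.2]]).
Proof.
have /derivableP q1P := dq1; have /derivableP p1P := dp1.
have /derivableP q2P := dq2; have /derivableP p2P := dp2.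
apply: mx_is_deriveN => i j.
case: i j => [[|[|//]] ?] [[|[|//]] ?]; rewrite mxE /=;
  under eq_fun do rewrite mxE /=; try exact: is_derive_cst.
  apply: is_derive_eq (is_deriveD (is_deriveD (is_deriveM p1P q1P)
    (is_deriveM p2P q2P)) (is_derive_cst thi1 t v)) _.
  by rewrite /GRing.scale /=; ring.
apply: is_derive_affine => h.
by case: t v => [? ?] [? ?]; rewrite addrC.
Qed.

Lemma commutator_E2_hat :
  commutator (E2 K) (hatAoo thi1 q1 p1 q2 p2 t + hatB thi1 q1 p1 q2 p2 t) = 0.
Proof. by apply: mx2_eq; rewrite !(commutator2E, mxE) /=; ring. Qed.

(** The constant term reads [w + p_1 = 0] in its lower left entry; this value is
    needed to turn the two Lax equations into Hamilton's equations. *)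
Lemma compatible_e1P : v = e1 ->
  (forall x, x != 0 -> x != t.2 - t.1 ->
     compatible v (matA th0 th1 thi1 q1 p1 q2 p2 u) (matB1 th1 q1 p1 u) x t) <->
  hamilton_eqs v (H_t1 th0 th1 thi1) q1 p1 q2 p2 t /\
    (u t)^-1 * 'D_v u t = - p1 t.
Proof.
move=> ve.
have s0 : t.2 - t.1 != 0 by rewrite subr_eq0 eq_sym.
have r0 : t.1 - t.2 != 0 by rewrite subr_eq0.
have v21 : v.2 - v.1 = -1 by rewrite ve sub0r.
have E := @compatible_poles _ u v (hatA0 th0 q2 p2) (hatA0 th1 q1 p1) _ _ _ _ _
  (-1) 0 t s0 v21 commutator_E2_hat u0 du (mx_is_derive_hatA0 th0 dq2 dp2)
  (mx_is_derive_hatA0 th1 dq1 dp1) mx_is_derive_hatAoo.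
rewrite [X in compatible _ _ X](_ : _ = matB1 th1 q1 p1 u) in E;
  last first.
  apply/funext => x; apply/funext => s.
  by rewrite opprK scale1r scale0r addr0.
apply: (iff_trans E) => {E}.
set w := (u t)^-1 * _.
have [gp1 gq1 gp2 gq2] :=
  H_t1_gradient th0 th1 thi1 t.1 t.2 (q1 t) (p1 t) (q2 t) (p2 t).
rewrite /hamilton_eqs gp1 gq1 gp2 gq2 {gp1 gq1 gp2 gq2}.
have v2 : v.2 = 0 by rewrite ve.
split.
  move=> [/(rank_one_isospectral _ _ _ _ _ th0_neq0) [q2E p2E]].
  move=> /(rank_one_isospectral _ _ _ _ _ th1_neq0) [q1E p1E].
  move=> /mx2_eq0[_ _ + _].
  rewrite !(commutator2E, mulmx2E, mxE, big_ord1) /= => wE.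
  have {}wE : w = - p1 t.
    by apply/eqP; rewrite -subr_eq0 -wE; apply/eqP; ring.
  split=> //; rewrite q2E p2E q1E p1E.
  by split; rewrite !(mulmx2E, mxE, big_ord1) /= wE; field; rewrite ?s0 ?r0.
move=> [[q1E p1E q2E p2E] wE]; split.
- apply/(rank_one_isospectral _ _ _ _ _ th0_neq0).
  rewrite q2E p2E !(mulmx2E, mxE, big_ord1) /= wE.
  by split; field; rewrite ?s0 ?r0.
- apply/(rank_one_isospectral _ _ _ _ _ th1_neq0).
  rewrite q1E p1E !(mulmx2E, mxE, big_ord1) /= wE.
  by split; field; rewrite ?s0 ?r0.
- apply: mx2_eq; rewrite !(commutator2E, mulmx2E, mxE, big_ord1) /= ?wE ?v2.
  all: rewrite ?q1E ?p1E ?q2E ?p2E.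
  all: by field; rewrite ?s0 ?r0.
Qed.

(** Same argument, with [w = t_2 - p_2] from the lower left entry of the constant
    term, and the gradient of [H_t2] obtained from that of [H_t1] by symmetry. *)
Lemma compatible_e2P : v = e2 ->
  (forall x, x != 0 -> x != t.2 - t.1 ->
     compatible v (matA th0 th1 thi1 q1 p1 q2 p2 u)
       (matB2 th1 thi1 q1 p1 q2 p2 u) x t) <->
  hamilton_eqs v (H_t2 th0 th1 thi1) q1 p1 q2 p2 t /\
    (u t)^-1 * 'D_v u t = t.2 - p2 t.
Proof.
move=> ve.
have s0 : t.2 - t.1 != 0 by rewrite subr_eq0 eq_sym.
have r0 : t.1 - t.2 != 0 by rewrite subr_eq0.
have v21 : v.2 - v.1 = 1 by rewrite ve subr0.
have E := @compatible_poles _ u v (hatA0 th0 q2 p2) (hatA0 th1 q1 p1) _ _ _ _ _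
  1 1 t s0 v21 commutator_E2_hat u0 du (mx_is_derive_hatA0 th0 dq2 dp2)
  (mx_is_derive_hatA0 th1 dq1 dp1) mx_is_derive_hatAoo.
rewrite [X in compatible _ _ X](_ : _ = matB2 th1 thi1 q1 p1 q2 p2 u) in E;
  last first.
  apply/funext => x; apply/funext => s.
  by rewrite scaleN1r scale1r [hatB _ _ _ _ _ _ - _]addrC addrA.
apply: (iff_trans E) => {E}.
set w := (u t)^-1 * _.
have -> : H_t2 th0 th1 thi1 = fun t1 t2 q1 p1 q2 p2 =>
    H_t1 th1 th0 thi1 t2 t1 q2 p2 q1 p1.
  by do 6![apply/funext => ?]; exact: H_t2E.
have [gp2 gq2 gp1 gq1] :=
  H_t1_gradient th1 th0 thi1 t.2 t.1 (q2 t) (p2 t) (q1 t) (p1 t).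
rewrite /hamilton_eqs gp1 gq1 gp2 gq2 {gp1 gq1 gp2 gq2}.
have v2 : v.2 = 1 by rewrite ve.
split.
  move=> [/(rank_one_isospectral _ _ _ _ _ th0_neq0) [q2E p2E]].
  move=> /(rank_one_isospectral _ _ _ _ _ th1_neq0) [q1E p1E].
  move=> /mx2_eq0[_ _ + _].
  rewrite !(commutator2E, mulmx2E, mxE, big_ord1) /= => wE.
  have {}wE : w = t.2 - p2 t.
    by apply/eqP; rewrite -subr_eq0 -wE; apply/eqP; ring.
  split=> //; rewrite q2E p2E q1E p1E.
  by split; rewrite !(mulmx2E, mxE, big_ord1) /= wE; field; rewrite ?s0 ?r0.
move=> [[q1E p1E q2E p2E] wE]; split.
- apply/(rank_one_isospectral _ _ _ _ _ th0_neq0).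
  rewrite q2E p2E !(mulmx2E, mxE, big_ord1) /= wE.
  by split; field; rewrite ?s0 ?r0.
- apply/(rank_one_isospectral _ _ _ _ _ th1_neq0).
  rewrite q1E p1E !(mulmx2E, mxE, big_ord1) /= wE.
  by split; field; rewrite ?s0 ?r0.
- apply: mx2_eq; rewrite !(commutator2E, mulmx2E, mxE, big_ord1) /= ?wE ?v2.
  all: rewrite ?q1E ?p1E ?q2E ?p2E.
  all: by field; rewrite ?s0 ?r0.
Qed.
End Pointwise.

Theorem mainTheorem11 (R : realType)
  (th0 th1 thi1 thi2 : Cplx R)
  (hsum : th0 + th1 + thi1 + thi2 = 0) (hth0 : th0 != 0) (hth1 : th1 != 0)
  (U : set (Cplx R * Cplx R)) (hU : domain U)
  (hUdiag : forall t, U t -> t.1 != t.2)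
  (q1 p1 q2 p2 u : Cplx R * Cplx R -> Cplx R)
  (hq1 : holomorphic_on U q1) (hp1 : holomorphic_on U p1)
  (hq2 : holomorphic_on U q2) (hp2 : holomorphic_on U p2)
  (hu : holomorphic_on U u) (hu0 : forall t, U t -> u t != 0) :
  (forall t, U t -> forall x : Cplx R, x != 0 -> x != t.2 - t.1 ->
     compatible e1 (matA th0 th1 thi1 q1 p1 q2 p2 u) (matB1 th1 q1 p1 u) x t
     /\ compatible e2 (matA th0 th1 thi1 q1 p1 q2 p2 u)
          (matB2 th1 thi1 q1 p1 q2 p2 u) x t)
  <->
  (forall t, U t ->
     [/\ hamilton_eqs e1 (H_t1 th0 th1 thi1) q1 p1 q2 p2 t,
         hamilton_eqs e2 (H_t2 th0 th1 thi1) q1 p1 q2 p2 t,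
         (u t)^-1 * 'D_e1 u t = - p1 t &
         (u t)^-1 * 'D_e2 u t = t.2 - p2 t]).
Proof.
have dU f t v : holomorphic_on U f -> U t -> derivable f t v.
  by move=> hf Ut; exact/diff_derivable/hf.
have u0 t : U t -> \forall s \near t, u s != 0.
  move=> Ut; have [oU _ _] := hU.
  by apply: filterS (open_nbhs_nbhs (conj oU Ut)).
have P1 t (Ut : U t) := compatible_e1P thi1 hth0 hth1 (hUdiag t Ut)
  (dU _ _ _ hq1 Ut) (dU _ _ _ hp1 Ut) (dU _ _ _ hq2 Ut) (dU _ _ _ hp2 Ut)
  (dU _ _ _ hu Ut) (u0 t Ut) erefl.
have P2 t (Ut : U t) := compatible_e2P thi1 hth0 hth1 (hUdiag t Ut)
  (dU _ _ _ hq1 Ut) (dU _ _ _ hp1 Ut) (dU _ _ _ hq2 Ut) (dU _ _ _ hp2 Ut)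
  (dU _ _ _ hu Ut) (u0 t Ut) erefl.
split=> [C t Ut|H t Ut x x0 xs].
  have [|H1 w1] := (P1 t Ut).1.
    by move=> x x0 xs; exact: (C t Ut x x0 xs).1.
  have [|H2 w2] := (P2 t Ut).1.
    by move=> x x0 xs; exact: (C t Ut x x0 xs).2.
  by split.
have [H1 H2 w1 w2] := H t Ut.
by split; [exact: (P1 t Ut).2 | exact: (P2 t Ut).2].
Qed.
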